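(* Let $m,n\in\mathbb N$ with $n\ge 2$, $\mathcal V=\{1,\dots,n\}$, $\mathcal E=\{(i,j)\in\mathcal V\times\mathcal V : i<j\}$, and let $G:\{1,\dots,m\}^n\to\mathbb R$. Let $F:\{1,\dots,m\}^n\to\mathbb R$ be a sum of bivariates, $F(x)=\sum_{(i,j)\in\mathcal E} f_{i,j}(x_i,x_j)$ with $f_{i,j}:\{1,\dots,m\}^2\to\mathbb R$. Then $F$ is a best $\ell^2$-approximation of $G$ by sums of bivariates if and only if $$\sum_{y\in\{1,\dots,m\}^{n-2}} G\big(z^{k,\ell}(a,b,y)\big)=\sum_{y\in\{1,\dots,m\}^{n-2}}F\big(z^{k,\ell}(a,b,y)\big)\qquad\text{for all } a,b\in\{1,\dots,m\}\text{ and all }(k,\ell)\in\mathcal E .$$ Moreover, if $n\ge 4$, the right-hand side of this condition equals $$m^{n-2}f_{k,\ell}(a,b)+m^{n-3}\Big(\sum_{j<k}\big(\overline{f_{j,k}}^1(a)+\overline{f_{j,\ell}}^1(b)\big)+\sum_{k<j<\ell}\big(\overline{f_{k,j}}^2(a)+\overline{f_{j,\ell}}^1(b)\big)+\sum_{\ell<j}\big(\overline{f_{k,j}}^2(a)+\overline{f_{\ell,j}}^2(b)\big)\Big)+m^{n-4}\sum_{\substack{(i,j)\in\mathcal E\\ i,j\notin\{k,\ell\}}}\overline{\overline{f_{i,j}}} .$$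
   Context: A best $\ell^2$-approximation of $G$ by sums of bivariates is a function $F$ of the form $F(x)=\sum_{(i,j)\in\mathcal E}f_{i,j}(x_i,x_j)$ that minimizes $\big(\sum_{x\in\{1,\dots,m\}^n}(G(x)-F(x))^2\big)^{1/2}$ among all functions of this form (with $\mathcal E$ all pairs $i<j$). For $(k,\ell)\in\mathcal E$, $a,b\in\{1,\dots,m\}$ and $y\in\{1,\dots,m\}^{n-2}$, $z^{k,\ell}(a,b,y):=(y_1,\dots,y_{k-1},a,y_k,\dots,y_{\ell-2},b,y_{\ell-1},\dots,y_{n-2})$, i.e. the point with $a$ in coordinate $k$, $b$ in coordinate $\ell$, and the entries of $y$ in order in the other coordinates. For $(i,j)\in\mathcal E$ and $s\in\{1,\dots,m\}$: $\overline{f_{i,j}}^1(s):=\sum_{x=1}^m f_{i,j}(x,s)$, $\overline{f_{i,j}}^2(s):=\sum_{x=1}^m f_{i,j}(s,x)$, and $\overline{\overline{f_{i,j}}}:=\sum_{x=1}^m\sum_{s=1}^m f_{i,j}(x,s)$. *)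

(* Defs.v *)
From mathcomp Require Import all_boot all_order all_algebra.
From mathcomp Require Import reals.

Set Implicit Arguments.
Unset Strict Implicit.
Unset Printing Implicit Defensive.

Import Order.TTheory GRing.Theory Num.Theory.
Local Open Scope ring_scope.

(* Coordinates and values are numbered from 0: {1, ..., n} is 'I_n,
   {1, ..., m} is 'I_m and {1, ..., m}^n is n.-tuple 'I_m. *)

Definition edges (n : nat) : {set 'I_n * 'I_n} :=
  [set e : 'I_n * 'I_n | (e.1 < e.2)%N].

(* Only the f i j with (i, j) \in edges n matter. *)
Definition bivariate_sum (R : realType) (m n : nat)
    (f : 'I_n -> 'I_n -> 'I_m -> 'I_m -> R) (x : n.-tuple 'I_m) : R :=
  \sum_(e in edges n) f e.1 e.2 (tnth x e.1) (tnth x e.2).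

Definition sum_of_bivariates (R : realType) (m n : nat)
    (F : n.-tuple 'I_m -> R) : Prop :=
  exists f : 'I_n -> 'I_n -> 'I_m -> 'I_m -> R,
    forall x, F x = bivariate_sum f x.

Definition l2dist (R : realType) (m n : nat) (G F : n.-tuple 'I_m -> R) : R :=
  Num.sqrt (\sum_(x : n.-tuple 'I_m) (G x - F x) ^+ 2).

Definition best_l2_approximation (R : realType) (m n : nat)
    (G F : n.-tuple 'I_m -> R) : Prop :=
  sum_of_bivariates F /\
  forall H : n.-tuple 'I_m -> R,
    sum_of_bivariates H -> l2dist G F <= l2dist G H.

(* For k < l the index into y is always < n - 2, so the default value a of nth
   is never used. *)
Definition zpoint (m n : nat) (k l : 'I_n) (a b : 'I_m)
    (y : (n - 2).-tuple 'I_m) : n.-tuple 'I_m :=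
  [tuple if i == k then a
         else if i == l then b
         else nth a y (if (i < k)%N then i : nat
                       else if (i < l)%N then i.-1
                       else i.-2)
  | i < n].

Definition marg1 (R : realType) (m : nat) (g : 'I_m -> 'I_m -> R) (s : 'I_m) :
  R := \sum_(x < m) g x s.

Definition marg2 (R : realType) (m : nat) (g : 'I_m -> 'I_m -> R) (s : 'I_m) :
  R := \sum_(x < m) g s x.

Definition grand_total (R : realType) (m : nat) (g : 'I_m -> 'I_m -> R) : R :=
  \sum_(x < m) \sum_(s < m) g x s.

(* Main.v *)
Require Import Defs.
From mathcomp Require Import all_boot all_order all_algebra.
From mathcomp Require Import reals.
From mathcomp Require Import zify ring lra.

Set Implicit Arguments.
Unset Strict Implicit.
Unset Printing Implicit Defensive.

Import Order.TTheory GRing.Theory Num.Theory.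
Local Open Scope ring_scope.

(** The functions [F] of the form considered are a linear space, spanned by the
    indicator functions of the fibers: for [k < l], the fiber of [(a, b)] is the
    set of the points [x] with [x_k = a] and [x_l = b].  By the usual
    perturbation argument and Pythagoras, [F] is the best approximation iff the
    residual [G - F] is orthogonal to each of these indicators
    ([best_l2_approximationP]), that is, iff [G] and [F] have the same sum over
    each fiber.  As [y] varies, [z^{k,l}(a,b,y)] runs bijectively through the
    fiber ([sum_zpoint]), so these are the stated equations.

    For the explicit formula, the sum of [F] over a fiber is computed edge by
    edge.  Fixing [r] coordinates leaves [m ^ (n - r)] points
    ([card_cylinder]), so the weight of the edge [(i, j)] has exponent [n - 2],
    [n - 3] or [n - 4] according to whether [(i, j)] has two, one or no endpoint
    in [{k, l}] ([edge_sum_split], [fiber_sum_bivariate]). *)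

(** * Slices and fibers *)

(** The expression bounded here is the [i]-th coordinate other than [k] and [l],
    in increasing order. *)
Lemma nth_other_coordinate_lt n (k l : 'I_n) (i : 'I_(n - 2)) : (k < l)%N ->
  ((if i < k then i : nat else if i.+1 < l then i.+1 else i.+2) < n)%N.
Proof.
by have := ltn_ord i; have := ltn_ord l; case: ifP; [|case: ifP]; lia.
Qed.

(** The sum of [H] over the slice of the points [z^{k,l}(a,b,y)] is its sum over
    the fiber of the points with value [a] at [k] and [b] at [l]. *)
Lemma sum_zpoint (V : nmodType) m n (k l : 'I_n) (a b : 'I_m)
    (H : n.-tuple 'I_m -> V) : (k < l)%N ->
  \sum_(y : (n - 2).-tuple 'I_m) H (zpoint k l a b y) =
  \sum_(x : n.-tuple 'I_m | (tnth x k == a) && (tnth x l == b)) H x.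
Proof.
(* The inverse of the map sending [y] to the point [z] deletes the coordinates
   [k] and [l]. *)
move=> kl; pose p i := Ordinal (nth_other_coordinate_lt i kl).
rewrite [RHS](reindex_onto (zpoint k l a b)
  (fun x => [tuple tnth x (p i) | i < n - 2])) /=; last first.
  move=> x /andP[/eqP xk /eqP xl]; apply: eq_from_tnth => i.
  rewrite tnth_mktuple.
  case: eqP => [->//|/eqP ik]; case: eqP => [->//|/eqP il].
  have lN := ltn_ord l; have iN := ltn_ord i.
  rewrite -!val_eqE /= in ik il.
  set j := (X in nth _ _ X).
  have jN : (j < n - 2)%N by rewrite /j; case: ifP; [|case: ifP]; lia.
  rewrite (nth_map (Ordinal jN)) ?size_enum_ord// /p.
  congr tnth; apply: val_inj => /=.
  rewrite nth_enum_ord// /j.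
  by case: (ltnP i k) => ?; [|case: (ltnP i l) => ?];
    case: ifP; try case: ifP; lia.
apply: eq_bigl => y; rewrite !tnth_mktuple !eqxx -(val_eqE l) /=.
rewrite gtn_eqF //= eqxx /=.
apply/esym/eqP/eq_from_tnth => i.
rewrite !tnth_mktuple -!val_eqE /=.
rewrite (tnth_nth a).
have iN := ltn_ord i; have lN := ltn_ord l.
case: (ltnP i k) => ik.
  have -> : (i == k :> nat) = false by lia.
  have -> : (i == l :> nat) = false by lia.
  by rewrite ik.
case: (ltnP i.+1 l) => il.
  have -> : (i.+1 == k :> nat) = false by lia.
  have -> : (i.+1 == l :> nat) = false by lia.
  have -> : (i.+1 < k)%N = false by lia.
  by rewrite il.
have -> : (i.+2 == k :> nat) = false by lia.
have -> : (i.+2 == l :> nat) = false by lia.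
have -> : (i.+2 < k)%N = false by lia.
by have -> : (i.+2 < l)%N = false by lia.
Qed.

Lemma uniq_map_inj_in (T1 T2 : eqType) (h : T1 -> T2) (s : seq T1) :
  uniq (map h s) -> {in s &, injective h}.
Proof.
elim: s => //= x s IH /andP[xs us] y z; rewrite !inE.
by case/predU1P=> [->|ys] /predU1P[->|zs] // e;
  [rewrite e map_f in xs | rewrite -e map_f in xs | apply: IH].
Qed.

(** A cylinder fixes the coordinates listed in [s] to the values listed there;
    the other coordinates are free. *)
Lemma card_cylinder m n (s : seq ('I_n * 'I_m)) : uniq (unzip1 s) ->
  #|[pred x : n.-tuple 'I_m | all (fun p => tnth x p.1 == p.2) s]|
    = (m ^ (n - size s))%N.
Proof.
move=> us.
(* The values that the constraints allow at coordinate [i]. *)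
pose A i := [pred v : 'I_m | all (fun p => (p.1 == i) ==> (v == p.2)) s].
have cA i : #|A i| = if i \in unzip1 s then 1%N else m.
  case: ifPn => [/mapP[[j v] /= jv ->{i}]|si].
    rewrite -(card1 v); apply: eq_card => u; rewrite !inE.
    apply/allP/eqP => [/(_ _ jv)/=|-> [j' v'] jv' /=].
      by rewrite eqxx => /eqP.
    apply/implyP => /eqP jj; apply/eqP.
    by case: (uniq_map_inj_in us jv' jv jj).
  rewrite -[RHS]card_ord; apply: eq_card => u; rewrite !inE.
  apply/allP => p ps; apply/implyP => /eqP pi.
  by rewrite -pi map_f in si.
transitivity #|family A|.
  rewrite -!sum1_card (reindex (@tuple_of_finfun _ n)) /=; last first.
    by exists (@finfun_of_tuple _ n) => x _;
      rewrite ?finfun_of_tupleK ?tuple_of_finfunK.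
  apply: eq_bigl => g; rewrite inE; apply/allP/familyP => [gA i|gA p ps].
    rewrite !inE; apply/allP => p /gA.
    rewrite tnth_map tnth_ord_tuple => /eqP <-.
    by apply/implyP => /eqP ->.
  have := gA p.1; rewrite !inE => /allP/(_ _ ps); rewrite eqxx /=.
  by rewrite tnth_map tnth_ord_tuple.
rewrite card_family foldrE big_map big_enum /=.
under eq_bigr do rewrite cA -if_neg.
rewrite -big_mkcondr /= prod_nat_const.
congr (m ^ _)%N; apply: (canRL (addnK _)); rewrite addnC.
have := cardC (mem (unzip1 s)).
rewrite (card_uniqP us) size_map card_ord; apply: etrans; congr (_ + _)%N.
Qed.

Lemma sum_cylinder (R : pzSemiRingType) m n (s : seq ('I_n * 'I_m)) (c : R) :
  uniq (unzip1 s) ->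
  \sum_(x : n.-tuple 'I_m | all (fun p => tnth x p.1 == p.2) s) c
    = m%:R ^+ (n - size s) * c.
Proof.
by move=> us; rewrite sumr_const -natrX -[LHS]mulr_natl card_cylinder.
Qed.

(** The next three lemmas sum, over a fiber, a function of zero, one or two of
    the free coordinates. *)
Lemma fiber_sum0 (R : pzSemiRingType) m n (k l : 'I_n) (a b : 'I_m) (c : R) :
  k != l ->
  \sum_(x : n.-tuple 'I_m | (tnth x k == a) && (tnth x l == b)) c
    = m%:R ^+ (n - 2) * c.
Proof.
move=> kl; rewrite -(sum_cylinder (s := [:: (k, a); (l, b)])) /= ?inE ?kl //.
by apply: eq_bigl => x; rewrite andbT.
Qed.

Lemma fiber_sum1 (R : pzSemiRingType) m n (k l i : 'I_n) (a b : 'I_m)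
    (g : 'I_m -> R) : k != l -> i != k -> i != l ->
  \sum_(x : n.-tuple 'I_m | (tnth x k == a) && (tnth x l == b)) g (tnth x i)
    = m%:R ^+ (n - 3) * \sum_s g s.
Proof.
move=> kl ik il.
rewrite (partition_big (fun x : n.-tuple 'I_m => tnth x i) xpredT) //=.
rewrite mulr_sumr; apply: eq_bigr => s _.
rewrite -(sum_cylinder (s := [:: (i, s); (k, a); (l, b)])) /=; last first.
  by rewrite !inE negb_or ik il kl.
under eq_bigr => x /andP[_ /eqP->] do [].
by apply: eq_bigl => x; rewrite andbT andbC.
Qed.

Lemma fiber_sum2 (R : realType) m n (k l i j : 'I_n) (a b : 'I_m)
    (g : 'I_m -> 'I_m -> R) :
  k != l -> i != j -> i != k -> i != l -> j != k -> j != l ->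
  \sum_(x : n.-tuple 'I_m | (tnth x k == a) && (tnth x l == b))
    g (tnth x i) (tnth x j) = m%:R ^+ (n - 4) * grand_total g.
Proof.
move=> kl ij ik il jk jl.
rewrite (partition_big (fun x : n.-tuple 'I_m => tnth x i) xpredT) //=.
rewrite mulr_sumr; apply: eq_bigr => s _.
rewrite (partition_big (fun x : n.-tuple 'I_m => tnth x j) xpredT) //=.
rewrite mulr_sumr; apply: eq_bigr => u _.
rewrite -(sum_cylinder (s := [:: (j, u); (i, s); (k, a); (l, b)])) /=;
  last first.
  by rewrite !inE !negb_or eq_sym ij ik il jk jl kl.
under eq_bigr => x /andP[/andP[_ /eqP->] /eqP->] do [].
by apply: eq_bigl => x; rewrite andbT andbC [(tnth x k == a) && _ && _]andbC.
Qed.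

(** * The normal equations *)

Lemma sum_fibers (R : pzSemiRingType) m n (E : n.-tuple 'I_m -> R)
    (d : 'I_m -> 'I_m -> R) (k l : 'I_n) :
  \sum_x E x * d (tnth x k) (tnth x l) =
  \sum_a \sum_b (\sum_(x | (tnth x k == a) && (tnth x l == b)) E x) * d a b.
Proof.
rewrite (partition_big (fun x : n.-tuple 'I_m => tnth x k) xpredT) //=.
apply: eq_bigr => a _.
rewrite (partition_big (fun x : n.-tuple 'I_m => tnth x l) xpredT) //=.
apply: eq_bigr => b _; rewrite big_distrl /=.
by apply: eq_bigr => x /andP[/eqP-> /eqP->].
Qed.

Lemma bivariate_sum_lin (R : realType) m n
    (f g : 'I_n -> 'I_n -> 'I_m -> 'I_m -> R)
    (t : R) (x : n.-tuple 'I_m) :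
  bivariate_sum (fun i j u v => f i j u v + t * g i j u v) x =
  bivariate_sum f x + t * bivariate_sum g x.
Proof. by rewrite /bivariate_sum big_distrr -big_split. Qed.

(** The indicator function of a fiber is itself a sum of bivariates. *)
Lemma bivariate_sum_fiber (R : realType) m n (k l : 'I_n) (a b : 'I_m)
    (x : n.-tuple 'I_m) : (k < l)%N ->
  bivariate_sum (fun i j u v =>
    (((i, j) == (k, l)) && ((u == a) && (v == b)))%:R : R) x =
  ((tnth x k == a) && (tnth x l == b))%:R.
Proof.
move=> kl; rewrite /bivariate_sum (bigD1 (k, l)) ?inE//= eqxx /=.
rewrite big1 ?addr0 // => e.
by case/andP=> _; rewrite -surjective_pairing => /negPf->.
Qed.

Lemma l2dist_le (R : realType) m n (G F H : n.-tuple 'I_m -> R) :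
  (l2dist G F <= l2dist G H) =
  (\sum_x (G x - F x) ^+ 2 <= \sum_x (G x - H x) ^+ 2).
Proof. by rewrite ler_sqrt // sumr_ge0 // => x _; apply: sqr_ge0. Qed.

(** The normal equations of the least squares problem: [F] is best iff the
    residual [G - F] is orthogonal to the indicator functions of the fibers. *)
Lemma best_l2_approximationP (R : realType) m n (G F : n.-tuple 'I_m -> R) :
  sum_of_bivariates F ->
  best_l2_approximation G F <->
  forall (a b : 'I_m) (k l : 'I_n), (k < l)%N ->
    \sum_(x : n.-tuple 'I_m | (tnth x k == a) && (tnth x l == b))
      (G x - F x) = 0.
Proof.
move=> bF; split=> [[_ best] a b k l kl|orth].
  set P := fun x : n.-tuple 'I_m => (tnth x k == a) && (tnth x l == b).
  set S := (X in X = _).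
  pose N : R := \sum_(x | P x) 1.
  have N0 : 0 <= N by apply: sumr_ge0.
  (* Moving [F] by [t] times the indicator changes the squared error by
     [t ^ 2 * N - 2 * t * S], which for this [t] equals [- t ^ 2 * (N + 2)];
     [N + 1] rather than [N] avoids dividing by zero. *)
  pose t := S / (N + 1).
  have [f fF] := bF.
  have /best : sum_of_bivariates (fun x => F x + t * (P x)%:R).
    exists (fun i j u v => f i j u v +
      t * (((i, j) == (k, l)) && ((u == a) && (v == b)))%:R) => x.
    by rewrite bivariate_sum_lin bivariate_sum_fiber // fF.
  rewrite l2dist_le.
  have -> : \sum_x (G x - (F x + t * (P x)%:R)) ^+ 2 =
      \sum_x (G x - F x) ^+ 2 - 2 * t * S + t ^+ 2 * N.
    rewrite /S /N (big_mkcond P) (big_mkcond P) /= !big_distrr -sumrN.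
    rewrite -!big_split /=.
    by apply: eq_bigr => x _; rewrite -/(P x); case: (P x) => /=; ring.
  have -> : S = t * (N + 1) by rewrite divfK // gt_eqF // ltr_wpDl.
  move=> tN; have t0 : t ^+ 2 * (N + 2) <= 0 by lra.
  have : t ^+ 2 == 0.
    by rewrite eq_le sqr_ge0 andbT -(pmulr_lle0 _ (_ : 0 < N + 2)) // ltr_wpDl.
  by rewrite sqrf_eq0 => /eqP->; rewrite mul0r.
split=> // H [h hH]; have [f fF] := bF.
rewrite l2dist_le.
have cross : \sum_x (G x - F x) * (F x - H x) = 0.
  have FH x : F x - H x =
      bivariate_sum (fun i j u v => f i j u v + -1 * h i j u v) x.
    by rewrite bivariate_sum_lin fF hH mulN1r.
  under eq_bigr => x _ do rewrite FH mulr_sumr.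
  rewrite exchange_big /= big1 // => -[k l]; rewrite inE /= => kl.
  rewrite (sum_fibers _ (fun u v => f k l u v + -1 * h k l u v)).
  by rewrite big1 // => a _; rewrite big1 // => b _; rewrite orth // mul0r.
have -> : \sum_x (G x - H x) ^+ 2 = \sum_x (G x - F x) ^+ 2 +
    2 * (\sum_x (G x - F x) * (F x - H x)) + \sum_x (F x - H x) ^+ 2.
  rewrite mulr_sumr -!big_split /=; apply: eq_bigr => x _; ring.
by rewrite cross mulr0 addr0 lerDl sumr_ge0 // => x _; apply: sqr_ge0.
Qed.

(** * Fiber sums of a sum of bivariates *)

Lemma sum_pairs_split (V : nmodType) n (k l : 'I_n) (W : 'I_n -> 'I_n -> V) :
  k != l ->
  \sum_i \sum_j W i j =
  (W k k + W k l + W l k + W l l)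
  + \sum_(j | (j != k) && (j != l)) (W j k + W k j + W j l + W l j)
  + \sum_(i | (i != k) && (i != l)) \sum_(j | (j != k) && (j != l)) W i j.
Proof.
move=> kl.
have D (g : 'I_n -> V) :
    \sum_j g j = g k + g l + \sum_(j | (j != k) && (j != l)) g j.
  by rewrite (bigD1 k) //= (bigD1 l) /= ?(eq_sym l) // addrA.
rewrite D !(D (W _)).
under [X in _ + X = _]eq_bigr => i _ do rewrite D.
rewrite !big_split /=.
by rewrite [LHS](AC (3*3*3) ((1*2*4*5)*(7*3*8*6)*9)).
Qed.

(** The edges other than [(k, l)] are sorted into those that meet [{k, l}],
    listed by their other endpoint [j], and those disjoint from it. *)
Lemma edge_sum_split (V : nmodType) n (k l : 'I_n) (T : 'I_n -> 'I_n -> V) :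
  (k < l)%N ->
  \sum_(e in edges n) T e.1 e.2 =
  T k l
  + (\sum_(j < n | (j < k)%N) (T j k + T j l)
     + \sum_(j < n | (k < j < l)%N) (T k j + T j l)
     + \sum_(j < n | (l < j)%N) (T k j + T l j))
  + \sum_(e in edges n | (e.1 \notin [:: k; l]) && (e.2 \notin [:: k; l]))
      T e.1 e.2.
Proof.
move=> kl.
(* Extending [T] by 0 off the edges turns the sum into one over all pairs. *)
pose W (i j : 'I_n) := if (i < j)%N then T i j else 0.
have -> : \sum_(e in edges n) T e.1 e.2 = \sum_i \sum_j W i j.
  by rewrite pair_bigA big_mkcond /=; apply: eq_bigr => -[i j] _; rewrite inE.
have neq_kl : k != l by rewrite -val_eqE /= ltn_eqF.
rewrite (sum_pairs_split _ neq_kl).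
rewrite {1 2 3 4}/W !ltnn kl ltnNge (ltnW kl) add0r !addr0; congr (_ + _ + _).
  rewrite big_mkcond [in RHS](big_mkcond (fun j : 'I_n => j < k)%N).
  rewrite [in RHS](big_mkcond (fun j : 'I_n => k < j < l)%N).
  rewrite [in RHS](big_mkcond (fun j : 'I_n => l < j)%N).
  rewrite -!big_split; apply: eq_bigr => j _ /=.
  rewrite /W -!val_eqE /=.
  case: (ltngtP j k) => [jk|kj|jk] /=.
  - have jl : (j < l)%N by apply: ltn_trans kl.
    by rewrite jl (ltn_eqF jl) ltnNge (ltnW jl) /= !addr0.
  - by case: (ltngtP j l) => _ /=; rewrite ?addr0 ?add0r.
  - by rewrite jk ltnNge (ltnW kl) /= !addr0.
rewrite pair_big [RHS]big_mkcond [LHS]big_mkcond; apply: eq_bigr => -[i j] _.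
by rewrite !inE /= !negb_or /W; case: (i < j)%N => //; case: ifP.
Qed.

(** For [n < 4] the exponent [n - 4] is truncated, and for [n < 3] so is
    [n - 3]; the sums that they multiply are then empty. *)
Lemma fiber_sum_bivariate (R : realType) m n (k l : 'I_n) (a b : 'I_m)
    (f : 'I_n -> 'I_n -> 'I_m -> 'I_m -> R) : (k < l)%N ->
  \sum_(x : n.-tuple 'I_m | (tnth x k == a) && (tnth x l == b))
    bivariate_sum f x =
  m%:R ^+ (n - 2) * f k l a b
  + m%:R ^+ (n - 3) *
    (\sum_(j < n | (j < k)%N) (marg1 (f j k) a + marg1 (f j l) b)
     + \sum_(j < n | (k < j < l)%N) (marg2 (f k j) a + marg1 (f j l) b)
     + \sum_(j < n | (l < j)%N) (marg2 (f k j) a + marg2 (f l j) b))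
  + m%:R ^+ (n - 4) *
    \sum_(e in edges n | (e.1 \notin [:: k; l]) && (e.2 \notin [:: k; l]))
      grand_total (f e.1 e.2).
Proof.
move=> lt_kl; have kl : k != l by rewrite -val_eqE /= ltn_eqF.
pose T (i j : 'I_n) : R :=
  \sum_(x : n.-tuple 'I_m | (tnth x k == a) && (tnth x l == b))
    f i j (tnth x i) (tnth x j).
(* [exchange_big] below turns the fiber sum into the sum of the [T i j] over
   the edges [(i, j)]. *)
have Tkl : T k l = m%:R ^+ (n - 2) * f k l a b.
  rewrite -(@fiber_sum0 _ _ _ k l a b) //.
  by apply: eq_bigr => x /andP[/eqP-> /eqP->].
have Tjk j : j != k -> j != l -> T j k = m%:R ^+ (n - 3) * marg1 (f j k) a.
  move=> jk jl; rewrite -(@fiber_sum1 _ _ _ k l j a b) //.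
  by apply: eq_bigr => x /andP[/eqP-> _].
have Tjl j : j != k -> j != l -> T j l = m%:R ^+ (n - 3) * marg1 (f j l) b.
  move=> jk jl; rewrite -(@fiber_sum1 _ _ _ k l j a b) //.
  by apply: eq_bigr => x /andP[_ /eqP->].
have Tkj j : j != k -> j != l -> T k j = m%:R ^+ (n - 3) * marg2 (f k j) a.
  move=> jk jl; rewrite -(@fiber_sum1 _ _ _ k l j a b) //.
  by apply: eq_bigr => x /andP[/eqP-> _].
have Tlj j : j != k -> j != l -> T l j = m%:R ^+ (n - 3) * marg2 (f l j) b.
  move=> jk jl; rewrite -(@fiber_sum1 _ _ _ k l j a b) //.
  by apply: eq_bigr => x /andP[_ /eqP->].
have neq (i j : 'I_n) : (i < j)%N -> (i != j) && (j != i).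
  by move=> ij; rewrite -!val_eqE /= ltn_eqF // gtn_eqF.
rewrite exchange_big (edge_sum_split T lt_kl) Tkl.
congr (_ + _ + _); first rewrite !mulrDr !mulr_sumr; first congr (_ + _ + _).
- apply: eq_bigr => j jk; rewrite mulrDr.
  have /andP[? _] := neq _ _ jk.
  have /andP[? _] := neq _ _ (ltn_trans jk lt_kl).
  by rewrite Tjk // Tjl.
- apply: eq_bigr => j /andP[kj jl]; rewrite mulrDr.
  have /andP[_ ?] := neq _ _ kj; have /andP[? _] := neq _ _ jl.
  by rewrite Tkj // Tjl.
- apply: eq_bigr => j lj; rewrite mulrDr.
  have /andP[_ ?] := neq _ _ lj.
  have /andP[_ ?] := neq _ _ (ltn_trans lt_kl lj).
  by rewrite Tkj // Tlj.
rewrite mulr_sumr; apply: eq_bigr => -[i j] /=.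
rewrite !inE /= !negb_or => /andP[/neq/andP[ij _]].
case/andP=> /andP[ik il] /andP[jk jl].
exact: fiber_sum2.
Qed.

Theorem mainTheorem1 (R : realType) (m n : nat) (hn : (2 <= n)%N)
    (G F : n.-tuple 'I_m -> R)
    (f : 'I_n -> 'I_n -> 'I_m -> 'I_m -> R)
    (hF : forall x : n.-tuple 'I_m, F x = bivariate_sum f x) :
  (best_l2_approximation G F <->
   forall (a b : 'I_m) (k l : 'I_n), (k, l) \in edges n ->
     \sum_(y : (n - 2).-tuple 'I_m) G (zpoint k l a b y) =
     \sum_(y : (n - 2).-tuple 'I_m) F (zpoint k l a b y))
  /\
  ((4 <= n)%N ->
   forall (a b : 'I_m) (k l : 'I_n), (k, l) \in edges n ->
     \sum_(y : (n - 2).-tuple 'I_m) F (zpoint k l a b y) =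
     m%:R ^+ (n - 2) * f k l a b
     + m%:R ^+ (n - 3) *
       (\sum_(j < n | (j < k)%N) (marg1 (f j k) a + marg1 (f j l) b)
        + \sum_(j < n | (k < j < l)%N) (marg2 (f k j) a + marg1 (f j l) b)
        + \sum_(j < n | (l < j)%N) (marg2 (f k j) a + marg2 (f l j) b))
     + m%:R ^+ (n - 4) *
       \sum_(e in edges n | (e.1 \notin [:: k; l]) && (e.2 \notin [:: k; l]))
         grand_total (f e.1 e.2)).
Proof.
have edgeE (k l : 'I_n) : ((k, l) \in edges n) = (k < l)%N by rewrite inE.
split=> [|_ a b k l]; last first.
  rewrite edgeE => kl; rewrite sum_zpoint // -fiber_sum_bivariate //.
  by apply: eq_bigr.
have bF : sum_of_bivariates F by exists f.
rewrite (best_l2_approximationP _ bF); split=> orth a b k l.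
  rewrite edgeE => kl; rewrite !sum_zpoint //.
  by apply/eqP; rewrite -subr_eq0 -sumrB orth.
move=> kl; rewrite sumrB.
by apply/eqP; rewrite subr_eq0 -!sum_zpoint // orth ?edgeE.
Qed.
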